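(* Let $M$ be a generalized quasi-Einstein normal metric contact pair manifold of type $(p,q)$, so that $$Ric(X_1,X_2)=\lambda g(X_1,X_2)+(2p-\lambda)\alpha_1(X_1)\alpha_1(X_2)+(2q-\lambda)\alpha_2(X_1)\alpha_2(X_2)$$ for a function $\lambda$ on $M$. If $\lambda$ is constant, then $M$ satisfies cyclic Ricci tensor, i.e. $$(\nabla_{X_1}Ric)(X_2,X_3)+(\nabla_{X_2}Ric)(X_3,X_1)+(\nabla_{X_3}Ric)(X_1,X_2)=0$$ for all $X_1,X_2,X_3\in\Gamma(TM)$.
   Context: A contact pair of type $(p,q)$ ($p,q$ positive integers) on a differentiable manifold $M$ of dimension $m=2p+2q+2$ is a pair of $1$-forms $(\alpha_1,\alpha_2)$ with $\alpha_1\wedge(d\alpha_1)^p\wedge\alpha_2\wedge(d\alpha_2)^q\neq 0$ everywhere, $(d\alpha_1)^{p+1}=0$ and $(d\alpha_2)^{q+1}=0$. Its Reeb vector fields $Z_1,Z_2$ are the unique vector fields with $\alpha_i(Z_j)=\delta_{ij}$ and $i_{Z_i}d\alpha_j=0$ for $i,j\in\{1,2\}$. An almost contact pair structure is $(\alpha_1,\alpha_2,\phi)$ with $\phi$ a $(1,1)$-tensor field satisfying $\phi^2=-I+\alpha_1\otimes Z_1+\alpha_2\otimes Z_2$ and $\phi Z_1=\phi Z_2=0$ (then $\phi$ has rank $2p+2q$ and $\alpha_i\circ\phi=0$). Throughout, $\phi$ is assumed decomposable, i.e. $T\mathcal F_i=\ker\alpha_i\cap\ker d\alpha_i$ is $\phi$-invariant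 for $i=1,2$. A Riemannian metric $g$ is associated if $g(X,\phi Y)=(d\alpha_1+d\alpha_2)(X,Y)$ and $g(X,Z_i)=\alpha_i(X)$ for $i=1,2$; with such $g$, $(M,\phi,Z_1,Z_2,\alpha_1,\alpha_2,g)$ is a metric (almost) contact pair manifold. Here $d\alpha(X,Y)=\frac12\big(X\alpha(Y)-Y\alpha(X)-\alpha([X,Y])\big)$. It is normal if the almost complex structures $J=\phi-\alpha_2\otimes Z_1+\alpha_1\otimes Z_2$ and $T=\phi+\alpha_2\otimes Z_1-\alpha_1\otimes Z_2$ are both integrable. $\nabla$ is the Levi-Civita connection of $g$ and $Ric$ its Ricci tensor. A normal metric contact pair manifold is generalized quasi-Einstein if there are functions $\lambda,\beta,\mu$ on $M$ with $Ric(X_1,X_2)=\lambda g(X_1,X_2)+\beta\alpha_1(X_1)\alpha_1(X_2)+\mu\alpha_2(X_1)\alpha_2(X_2)$ for all $X_1,X_2\in\Gamma(TM)$; necessarily $\beta=2p-\lambda$ and $\mu=2q-\lambda$. *)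

(* Defs.v *)
From HB Require Import structures.
From mathcomp Require Import all_boot all_order all_algebra all_fingroup.
From mathcomp Require Import all_classical all_reals all_analysis.
From mathcomp Require Import ring.

Set Implicit Arguments.
Unset Strict Implicit.
Unset Printing Implicit Defensive.

Import Order.TTheory GRing.Theory Num.Theory.
Import numFieldNormedType.Exports.

Local Open Scope classical_set_scope.
Local Open Scope ring_scope.

Section SmoothOn.
Context {R : realType} {n : nat}.
Implicit Types (U : set 'rV[R]_n) (f g : 'rV[R]_n -> R).

(* Class C^k on an open set: all iterated partial derivatives of order at most
   k exist and are continuous at every point of U.  Outside U the derivatives
   take junk values, which are never looked at. *)
Fixpoint Ck_on (k : nat) U f : Prop :=
  (forall u, U u -> {for u, continuous f}) /\
  (if k is k'.+1 then
     forall i : 'I_n, (forall u, U u -> derivable f u (delta_mx 0 i)) /\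
                      Ck_on k' U ('D_(delta_mx 0 i) f)
   else True).

Definition smooth_on U f : Prop := forall k, Ck_on k U f.

Lemma Ck_onW k U f : Ck_on k.+1 U f -> Ck_on k U f.
Proof.
elim: k f => [|k IH] f; first by case.
by case=> cf df; split=> // i; have [di ci] := df i; split=> //; exact: IH.
Qed.

Lemma Ck_on_ext k U f g : open U -> {in U, f =1 g} -> Ck_on k U f -> Ck_on k U g.
Proof.
move=> oU fg.
have near_fg (h1 h2 : _ -> R) : {in U, h1 =1 h2} ->
    forall u, U u -> \forall y \near u, h1 y = h2 y.
  move=> h12 u Uu; apply: filterS (open_nbhs_nbhs (conj oU Uu)) => y Uy.
  by apply: h12; rewrite inE.
have cont_ext (h1 h2 : _ -> R) : {in U, h1 =1 h2} ->
    (forall u, U u -> {for u, continuous h1}) ->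
    forall u, U u -> {for u, continuous h2}.
  move=> h12 ch1 u Uu; rewrite /prop_for /continuous_at -h12 ?inE//.
  apply: cvg_trans (ch1 _ Uu); 
  exact: (near_eq_cvg (FF := nbhs_filter u) (near_fg _ _ h12 _ Uu)).
elim: k f g fg => [|k IH] f g fg [cf df]; first by split=> //; exact: cont_ext cf.
split=> [|i]; first exact: cont_ext cf.
have [di ci] := df i; split=> [u Uu|].
  exact: near_eq_derivable (near_fg _ _ fg _ Uu) (di _ Uu).
apply: IH ci => u /[!inE] Uu; exact: near_eq_derive (near_fg _ _ fg _ Uu).
Qed.

Lemma Ck_on_cst k U (c : R) : Ck_on k U (cst c).
Proof.
elim: k c => [|k IH] c; first by split=> // u _; exact: cst_continuous.
split=> [u _|i]; first exact: cst_continuous.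
split=> [u _|]; first exact: derivable_cst.
suff -> : 'D_(delta_mx 0 i) (cst c) = cst 0 :> ('rV[R]_n -> R) by [].
by apply/funext => u; rewrite derive_cst.
Qed.

Lemma Ck_onD k U f g : open U ->
  Ck_on k U f -> Ck_on k U g -> Ck_on k U (f \+ g).
Proof.
move=> oU; elim: k f g => [|k IH] f g [cf df] [cg dg].
  by split=> // u Uu; apply: continuousD; [exact: cf|exact: cg].
split=> [u Uu|i]; first by apply: continuousD; [exact: cf|exact: cg].
have [[dfi cfi] [dgi cgi]] := (df i, dg i); split=> [u Uu|].
  by apply: derivableD; [exact: dfi|exact: dgi].
apply: Ck_on_ext (IH _ _ cfi cgi) => // u /[!inE] Uu.
by rewrite [RHS]deriveD//; [exact: dfi|exact: dgi].
Qed.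

Lemma Ck_onM k U f g : open U ->
  Ck_on k U f -> Ck_on k U g -> Ck_on k U (f \* g).
Proof.
move=> oU; elim: k f g => [|k IH] f g sf sg; have [[cf df] [cg dg]] := (sf, sg).
  by split=> // u Uu; apply: continuousM; [exact: cf|exact: cg].
split=> [u Uu|i]; first by apply: continuousM; [exact: cf|exact: cg].
have [[dfi cfi] [dgi cgi]] := (df i, dg i); split=> [u Uu|].
  by apply: derivableM; [exact: dfi|exact: dgi].
apply: Ck_on_ext (Ck_onD oU (IH _ _ (Ck_onW sf) cgi) (IH _ _ (Ck_onW sg) cfi)) => //.
move=> u /[!inE] Uu.
by rewrite [RHS]deriveM//; [exact: dfi|exact: dgi].
Qed.

End SmoothOn.

Record chart (R : realType) (n : nat) (M : topologicalType) := Chart {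
  chart_dom : set M;
  chart_map :> M -> 'rV[R]_n;
  chart_inv : 'rV[R]_n -> M;
  chart_dom_open : open chart_dom;
  chart_img_open : open (chart_map @` chart_dom);
  chart_mapK : {in chart_dom, cancel chart_map chart_inv};
  chart_map_continuous : forall x, chart_dom x -> {for x, continuous chart_map};
  chart_inv_continuous :
    forall u, (chart_map @` chart_dom) u -> {for u, continuous chart_inv} }.

Record manifold (R : realType) (n : nat) := Manifold {
  manifold_space :> topologicalType;
  manifold_hausdorff : hausdorff_space manifold_space;
  manifold_second_countable : @second_countable manifold_space;
  atlas : set (chart R n manifold_space);
  atlas_cover : forall x, exists2 c, atlas c & chart_dom c x;
  atlas_smooth : forall c d, atlas c -> atlas d -> forall j : 'I_n,
    smooth_on (c @` (chart_dom c `&` chart_dom d))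
              (fun u => d (chart_inv c u) 0 j) }.

Section SmoothFunctions.
Context {R : realType} {n : nat} (M : manifold R n).

Definition smooth (f : M -> R) : Prop := forall c, atlas c ->
  smooth_on (c @` chart_dom c) (fun u => f (chart_inv c u)).

Definition smooth_pred : {pred M -> R} := mem [set f | smooth f].

Lemma smooth_cst (a : R) : smooth (cst a).
Proof. by move=> c _ k; exact: Ck_on_cst. Qed.

Lemma smoothD (f g : M -> R) : smooth f -> smooth g -> smooth (f \+ g).
Proof.
move=> sf sg c ac k; apply: (Ck_onD (f := f \o chart_inv c)).
- exact: chart_img_open.
- exact: sf.
- exact: sg.
Qed.

Lemma smoothM (f g : M -> R) : smooth f -> smooth g -> smooth (f \* g).
Proof.
move=> sf sg c ac k; apply: (Ck_onM (f := f \o chart_inv c)).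
- exact: chart_img_open.
- exact: sf.
- exact: sg.
Qed.

Lemma smooth_pred_scaler : GRing.scaler_closed smooth_pred.
Proof. by move=> a f; rewrite !inE => sf; exact: (smoothM (smooth_cst a) sf). Qed.

Lemma smooth_pred_subring : subring_closed smooth_pred.
Proof.
split=> [|f g|f g]; rewrite !inE; first exact: (smooth_cst 1).
- move=> sf sg; apply: smoothD => //.
  by have := smooth_pred_scaler (-1) (mem_set sg); rewrite scaleN1r inE.
- exact: smoothM.
Qed.

HB.instance Definition _ := GRing.isSubringClosed.Build _ smooth_pred
  smooth_pred_subring.
HB.instance Definition _ := GRing.isScaleClosed.Build _ _ smooth_pred
  smooth_pred_scaler.

Record smooth_fun :=
  SmoothFun { smooth_fun_val :> M -> R; _ : smooth_fun_val \in smooth_pred }.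

HB.instance Definition _ := [isSub for smooth_fun_val].
HB.instance Definition _ := [Choice of smooth_fun by <:].
HB.instance Definition _ := 
  GRing.SubChoice_isSubComPzRing.Build _ _ smooth_fun smooth_pred_subring.
HB.instance Definition _ := [SubZmodule_isSubLmodule of smooth_fun by <:].

End SmoothFunctions.

Notation "''C^oo' ( M )" := (smooth_fun M) (format "''C^oo' ( M )").

Section TensorCalculus.
Context {R : realType} {n : nat} (M : manifold R n).
Local Notation F := 'C^oo(M).

(* A vector field, seen through the values (X f)(x): for each x, f |-> X f x is
   a derivation at x of the algebra of germs of smooth functions, and X f is
   smooth whenever f is. *)
Definition is_vector_field (X : F -> F) : Prop :=
  [/\ forall (a : R) (f h : F), X (a *: f + h) = a *: X f + X h,
      forall f h : F, X (f * h) = X f * h + f * X h &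
      forall (x : M) (f h : F), (\forall y \near x, f y = h y) -> X f x = X h x].

Definition vector_field_pred : {pred F -> F^o} := mem [set X | is_vector_field X].

Lemma vector_field_pred_submod : submod_closed vector_field_pred.
Proof.
split=> [|h X Y]; rewrite !inE /=.
  split=> [a f g|f g|x f g _] //; first by rewrite scaler0 addr0.
  by rewrite mul0r mulr0 addr0.
move=> [X1 X2 X3] [Y1 Y2 Y3]; split=> [a f g|f g|x f g fg] /=.
- apply/val_inj/funext => x; rewrite [h *: X]/GRing.scale/= X1 Y1.
  rewrite /= !fctE /= /GRing.scale/=.
  ring.
- apply/val_inj/funext => x; rewrite [h *: X]/GRing.scale/= X2 Y2.
  rewrite /= !fctE /= /GRing.scale/=.
  ring.
- by rewrite /= !fctE /= (X3 x _ _ fg) (Y3 x _ _ fg).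
Qed.

HB.instance Definition _ := GRing.isSubmodClosed.Build _ _ vector_field_pred
  vector_field_pred_submod.

Record vector_field := VectorField {
  vector_field_val :> F -> F^o; _ : vector_field_val \in vector_field_pred }.

HB.instance Definition _ := [isSub for vector_field_val].
HB.instance Definition _ := [Choice of vector_field by <:].
HB.instance Definition _ := [SubChoice_isSubLmodule of vector_field by <:].

Local Notation V := vector_field.
Implicit Types (X Y Z : V) (x : M).

Lemma vector_fieldP X : is_vector_field X.
Proof. by case: X => X /=; rewrite inE. Qed.

Definition bracket_fun X Y : F -> F^o := fun f => X (Y f) - Y (X f).

Lemma bracket_subproof X Y : bracket_fun X Y \in vector_field_pred.
Proof.
have [X1 X2 X3] := vector_fieldP X; have [Y1 Y2 Y3] := vector_fieldP Y.
rewrite inE /bracket_fun; split=> [a f g|f g|x f g fg].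
- by rewrite X1 Y1 X1 Y1; apply/val_inj/funext => x /=;
    rewrite !fctE /= /GRing.scale/=; ring.
- have XD u v : X (u + v) = X u + X v by have := X1 1 u v; rewrite !scale1r.
  have YD u v : Y (u + v) = Y u + Y v by have := Y1 1 u v; rewrite !scale1r.
  rewrite X2 Y2 XD YD !X2 !Y2; apply/val_inj/funext => x /=.
  by rewrite !fctE /=; ring.
- have XY : X (Y f) x = X (Y g) x.
    by apply: X3; apply: filterS (near_join fg) => y; exact: Y3.
  have YX : Y (X f) x = Y (X g) x.
    by apply: Y3; apply: filterS (near_join fg) => y; exact: X3.
  by rewrite /= !fctE /= XY YX.
Qed.

Definition bracket X Y : V := VectorField (bracket_subproof X Y).

(* The tangent vector X_x is zero. *)
Definition vanishes_at X x : Prop := forall f : F, X f x = 0.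

(* Tensor fields are multilinear maps over the ring of smooth functions;
   in particular one-forms are the linear maps V -> F^o. *)
Definition one_form := {linear V -> F^o}.

(* A k-form given by its values on k vector fields. *)
Definition form (k : nat) := ('I_k -> V) -> F.

Definition form0 : form 0 := fun=> 1.
Definition form1 (a : V -> F) : form 1 := fun E => a (E ord0).
Definition form2 (w : V -> V -> F) : form 2 := fun E => w (E ord0) (E ord_max).

(* The normalisation of the wedge product matches the factor 1/2 in [ext_d]. *)
Definition wedge k l (a : form k) (b : form l) : form (k + l) := fun E =>
  ((k + l)`!%:R^-1 : R) *: \sum_(s : 'S_(k + l)) (-1) ^+ s *
     (a (fun i => E (s (lshift l i))) * b (fun j => E (s (rshift k j)))).

Fixpoint wedge_pow (w : form 2) (k : nat) : form (k * 2) :=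
  match k return form (k * 2) with
  | 0 => form0
  | k'.+1 => wedge w (@wedge_pow w k')
  end.
Arguments wedge_pow : clear implicits.

(* dα(X,Y) = (X(α(Y)) - Y(α(X)) - α([X,Y])) / 2 *)
Definition ext_d (a : one_form) X Y : F :=
  (2^-1 : R) *: (X (a Y) - Y (a X) - a (bracket X Y)).

Definition contact_pair (p q : nat) (a1 a2 : one_form) : Prop :=
  [/\ forall x, exists E,
        wedge (wedge (wedge (form1 a1) (wedge_pow (form2 (ext_d a1)) p))
                     (form1 a2))
              (wedge_pow (form2 (ext_d a2)) q) E x != 0,
      forall E, wedge_pow (form2 (ext_d a1)) p.+1 E = 0 &
      forall E, wedge_pow (form2 (ext_d a2)) q.+1 E = 0].

Definition reeb_fields (a1 a2 : one_form) (Z1 Z2 : V) : Prop :=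
  [/\ [/\ a1 Z1 = 1, a1 Z2 = 0, a2 Z1 = 0 & a2 Z2 = 1],
      forall Y, ext_d a1 Z1 Y = 0 /\ ext_d a2 Z1 Y = 0 &
      forall Y, ext_d a1 Z2 Y = 0 /\ ext_d a2 Z2 Y = 0].

Definition almost_contact_pair (a1 a2 : one_form) (Z1 Z2 : V)
    (phi : {linear V -> V}) : Prop :=
  [/\ forall X, phi (phi X) = - X + (a1 X : F) *: Z1 + (a2 X : F) *: Z2,
      phi Z1 = 0 & phi Z2 = 0].

(* X_x lies in the characteristic distribution ker α ∩ ker dα at x. *)
Definition in_characteristic (a : one_form) X x : Prop :=
  a X x = 0 /\ forall Y, ext_d a X Y x = 0.

Definition decomposable (a1 a2 : one_form) (phi : {linear V -> V}) : Prop :=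
  forall X x, (in_characteristic a1 X x -> in_characteristic a1 (phi X) x) /\
              (in_characteristic a2 X x -> in_characteristic a2 (phi X) x).

Definition riemannian_metric (g : V -> V -> F) : Prop :=
  [/\ forall X Y, g X Y = g Y X,
      forall (f : F) X Y Z, g (f *: X + Y) Z = f * g X Z + g Y Z &
      forall X x, ~ vanishes_at X x -> 0 < g X X x].

Definition associated_metric (a1 a2 : one_form) (Z1 Z2 : V)
    (phi : {linear V -> V}) (g : V -> V -> F) : Prop :=
  [/\ forall X Y, g X (phi Y) = ext_d a1 X Y + ext_d a2 X Y,
      forall X, g X Z1 = a1 X &
      forall X, g X Z2 = a2 X].

(* An almost complex structure J is integrable when it comes from a complex
   structure: near every point there are complex coordinates z_i = u_i + i v_i
   with dz_i o J = i dz_i.  By the inverse function theorem, 2k = dim M functions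
   are local coordinates iff no nonzero tangent vector is killed by all their
   differentials.  A cutoff makes the functions global without changing their
   germs at the given point. *)
Definition integrable (J : V -> V) : Prop :=
  forall x, exists (k : nat) (u v : 'I_k -> F),
    [/\ k.*2 = n,
        \forall y \near x, forall X i,
          J X (u i) y = - X (v i) y /\ J X (v i) y = X (u i) y &
        \forall y \near x, forall X,
          (forall i, X (u i) y = 0 /\ X (v i) y = 0) -> vanishes_at X y].

Definition contact_pair_J (a1 a2 : one_form) (Z1 Z2 : V)
    (phi : {linear V -> V}) X : V :=
  phi X - (a2 X : F) *: Z1 + (a1 X : F) *: Z2.

Definition contact_pair_T (a1 a2 : one_form) (Z1 Z2 : V)
    (phi : {linear V -> V}) X : V :=
  phi X + (a2 X : F) *: Z1 - (a1 X : F) *: Z2.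

Definition normal_metric_contact_pair (p q : nat) (a1 a2 : one_form)
    (Z1 Z2 : V) (phi : {linear V -> V}) (g : V -> V -> F) : Prop :=
  [/\ contact_pair p q a1 a2 /\ reeb_fields a1 a2 Z1 Z2,
      almost_contact_pair a1 a2 Z1 Z2 phi /\ decomposable a1 a2 phi,
      riemannian_metric g /\ associated_metric a1 a2 Z1 Z2 phi g,
      integrable (contact_pair_J a1 a2 Z1 Z2 phi) &
      integrable (contact_pair_T a1 a2 Z1 Z2 phi)].

Definition levi_civita (g : V -> V -> F) (nabla : V -> V -> V) : Prop :=
  [/\ forall (f : F) X Y Z, nabla (f *: X + Y) Z = f *: nabla X Z + nabla Y Z,
      forall X Y Z, nabla X (Y + Z) = nabla X Y + nabla X Z,
      forall (f : F) X Y, nabla X (f *: Y) = (X f : F) *: Y + f *: nabla X Y,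
      forall X Y, nabla X Y - nabla Y X = bracket X Y &
      forall X Y Z, X (g Y Z) = g (nabla X Y) Z + g Y (nabla X Z)].

Definition curvature (nabla : V -> V -> V) X Y Z : V :=
  nabla X (nabla Y Z) - nabla Y (nabla X Z) - nabla (bracket X Y) Z.

(* t is the pointwise trace of the endomorphism A: at each point it is computed
   in any n vector fields E_i and one-forms th_i which are dual there, hence
   bases of the tangent and cotangent space since dim M = n. *)
Definition is_trace (A : V -> V) (t : F) : Prop :=
  forall x (E : 'I_n -> V) (th : 'I_n -> one_form),
    (forall i j, th i (E j) x = (i == j)%:R) ->
    t x = \sum_i (th i (A (E i)) : F) x.

(* Ric(X,Y) is the trace of Z |-> R(Z,X)Y. *)
Definition is_ricci (nabla : V -> V -> V) (Ric : V -> V -> F) : Prop :=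
  forall X Y, is_trace (fun Z => curvature nabla Z X Y) (Ric X Y).

(* (∇_X B)(Y,Z) *)
Definition covariant_derivative (nabla : V -> V -> V) (B : V -> V -> F)
    X Y Z : F :=
  X (B Y Z) - B (nabla X Y) Z - B Y (nabla X Z).

Definition generalized_quasi_einstein (Ric g : V -> V -> F) (a1 a2 : one_form)
    (lambda beta mu : M -> R) : Prop :=
  forall X Y x, Ric X Y x = lambda x * g X Y x
                          + beta x * (a1 X : F) x * (a1 Y : F) x
                          + mu x * (a2 X : F) x * (a2 Y : F) x.

Definition cyclic_ricci (nabla : V -> V -> V) (Ric : V -> V -> F) : Prop :=
  forall X1 X2 X3, covariant_derivative nabla Ric X1 X2 X3
                 + covariant_derivative nabla Ric X2 X3 X1
                 + covariant_derivative nabla Ric X3 X1 X2 = 0.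

End TensorCalculus.

(* Main.v *)
Require Import Defs.
From mathcomp Require Import all_boot all_order all_algebra.
From mathcomp Require Import all_classical all_reals all_analysis.
From mathcomp Require Import ring lra.
Import Order.TTheory GRing.Theory Num.Theory.
Local Open Scope ring_scope.

Set Implicit Arguments.
Unset Strict Implicit.
Unset Printing Implicit Defensive.

(** On a normal metric contact pair manifold both Reeb fields are Killing, and
the cyclic condition follows from this by skew-symmetry.

Let [lambda] be constant, so that [Ric] is a combination with constant
coefficients of [g], [a1 (x) a1] and [a2 (x) a2].  The covariant derivative of
[g] is zero.  As [a_i] is the metric dual of [Z_i], the covariant derivative of
[a_i] is the bilinear map sending [X], [Y] to [g Y (nabla X Z_i)].  It is
skew-symmetric exactly when [Z_i] is Killing ([killing_nabla]), and then the
cyclic sum of the covariant derivative of [a_i (x) a_i] cancels in pairs.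

That the Reeb fields are Killing ([reeb_killing]) is seen as follows, with [L]
the Lie derivative.  The forms [a_j] and [d a_j] are invariant under [Z_i]
([lie_one_form], [lie_ext_d]).  Since [g X (phi Y)] is the value of
[d a1 + d a2], and [g X Z_j] that of [a_j], the metric is invariant under [Z_i]
as soon as [phi] and both Reeb fields are.  The Reeb fields commute, by
nondegeneracy of [g] ([bracket_reeb]).  For [phi], the Nijenhuis tensor of an
integrable almost complex structure vanishes ([integrable_nijenhuis]).  As [J]
sends [Z1] to [Z2], evaluating the tensor of [J] at [Z1] and [Y] gives
[L_Z2 phi = phi (L_Z1 phi)].  The structure [T] is the [J] of the pair with its
two members exchanged, so it gives [L_Z1 phi = phi (L_Z2 phi)]
([lie_phi_exchange]).  Together, [L_Z1 phi = phi (phi (L_Z1 phi))], which is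
[- L_Z1 phi] because [L_Z1 phi] takes values in the kernel of [a1] and [a2];
hence [L_Z1 phi = 0] ([lie_phi0]).

The hypotheses are symmetric under exchange of the two members of the pair,
which also exchanges [J] and [T] ([metric_pair_swap], [contact_pair_T_swap]),
so statements are proved for [Z1] and transported to [Z2]. *)

(** * Vector fields as derivations *)

Section VectorFields.
Context {R : realType} {n : nat} {M : manifold R n}.
Local Notation F := 'C^oo(M).
Local Notation V := (vector_field M).
Implicit Types (X Y Z : V) (f h : F).

Lemma smooth_fun_ext f h : (forall x, f x = h x) -> f = h.
Proof. by move=> fh; apply/val_inj/funext. Qed.

Lemma addFE f h x : (f + h) x = f x + h x. Proof. by []. Qed.
Lemma oppFE f x : (- f) x = - f x. Proof. by []. Qed.
Lemma mulFE f h x : (f * h) x = f x * h x. Proof. by []. Qed.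
Lemma scaleFE (c : R) f x : (c *: f) x = c * f x. Proof. by []. Qed.
Lemma zeroFE x : (0 : F) x = 0. Proof. by []. Qed.
Lemma oneFE x : (1 : F) x = 1. Proof. by []. Qed.
Definition FE := (addFE, oppFE, mulFE, scaleFE, zeroFE, oneFE).

Lemma vector_field_ext X Y : (forall f, X f = Y f) -> X = Y.
Proof. by move=> XY; apply/val_inj/funext. Qed.

Lemma addVE X Y f : (X + Y) f = X f + Y f. Proof. by []. Qed.
Lemma oppVE X f : (- X) f = - X f. Proof. by []. Qed.
Lemma scaleVE h X f : (h *: X) f = h * X f. Proof. by []. Qed.
Lemma zeroVE f : (0 : V) f = 0. Proof. by []. Qed.
Lemma bracketE X Y f : bracket X Y f = X (Y f) - Y (X f). Proof. by []. Qed.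
Definition VE := (addVE, oppVE, scaleVE, zeroVE, bracketE).

Lemma vfM X f h : X (f * h) = X f * h + f * X h.
Proof. by case: (vector_fieldP X). Qed.

Lemma vfD X f h : X (f + h) = X f + X h.
Proof. by case: (vector_fieldP X) => /(_ 1 f h); rewrite !scale1r. Qed.

Lemma vf0 X : X 0 = 0.
Proof. by apply: (addrI (X 0)); rewrite -vfD !addr0. Qed.

Lemma vfN X f : X (- f) = - X f.
Proof. by apply: (addrI (X f)); rewrite -vfD !subrr vf0. Qed.

Lemma vfZ X (c : R) f : X (c *: f) = c *: (X f : F).
Proof. by case: (vector_fieldP X) => /(_ c f 0); rewrite vf0 !addr0. Qed.

Lemma vf1 X : X 1 = 0.
Proof.
apply: (addrI (X 1)).
by rewrite addr0 -[in RHS](mulr1 1) vfM mulr1 mul1r.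
Qed.

Lemma bracketxx Z : bracket Z Z = 0.
Proof. by apply: vector_field_ext => f; rewrite VE subrr. Qed.

Lemma bracketC Z W : bracket Z W = - bracket W Z.
Proof. by apply: vector_field_ext => f; rewrite !VE opprB. Qed.

Lemma bracketDr Z X Y : bracket Z (X + Y) = bracket Z X + bracket Z Y.
Proof.
apply: vector_field_ext => f; rewrite !VE vfD.
by apply: smooth_fun_ext => x; rewrite !FE; ring.
Qed.

Lemma bracketNr Z X : bracket Z (- X) = - bracket Z X.
Proof.
apply: vector_field_ext => f; rewrite !VE vfN.
by apply: smooth_fun_ext => x; rewrite !FE; ring.
Qed.

Lemma bracketZr X Y f : bracket X (f *: Y) = (X f : F) *: Y + f *: bracket X Y.
Proof.
apply: vector_field_ext => h; rewrite !VE vfM.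
by apply: smooth_fun_ext => x; rewrite !FE; ring.
Qed.

Lemma one_formZ (a : one_form M) (f : F) X : a (f *: X) = f * a X.
Proof. exact: linearZ. Qed.

End VectorFields.

(** * Integrable almost complex structures *)

Section Nijenhuis.
Context {R : realType} {n : nat} {M : manifold R n}.
Local Notation F := 'C^oo(M).
Local Notation V := (vector_field M).
Implicit Types (X Y Z : V) (f h : F) (J : V -> V).

Definition nijenhuis J X Y : V :=
  bracket (J X) (J Y) - bracket X Y - J (bracket (J X) Y) - J (bracket X (J Y)).

(** The coordinates [u_i + i v_i] are holomorphic near the point, so a factor
[J] next to them can be traded for an exchange of [u_i] and [v_i]; the terms of
the Nijenhuis tensor applied to a coordinate then cancel.  A vector killed by
the differentials of all coordinates is zero. *)
Lemma integrable_nijenhuis J X Y : Defs.integrable J -> nijenhuis J X Y = 0.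
Proof.
move=> intJ; apply: vector_field_ext => f; apply: smooth_fun_ext => x.
have [k [u [v [_ uv inj]]]] := intJ x.
(* The holomorphy relations hold on a neighbourhood of [x], hence survive
   differentiation along any vector field. *)
have XJu (W W' : V) i : W (J W' (u i)) x = - W (W' (v i)) x.
  have [_ _ loc] := vector_fieldP W.
  rewrite -oppFE -vfN; apply: loc; apply: filterS uv => y uvy.
  by have [-> _] := uvy W' i.
have XJv (W W' : V) i : W (J W' (v i)) x = W (W' (u i)) x.
  have [_ _ loc] := vector_fieldP W.
  apply: loc; apply: filterS uv => y uvy.
  by have [_ ->] := uvy W' i.
apply: (nbhs_singleton inj (nijenhuis J X Y)) => i.
have [Ju1 Jv1] := nbhs_singleton uv (bracket (J X) Y) i.
have [Ju2 Jv2] := nbhs_singleton uv (bracket X (J Y)) i.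
by rewrite !VE !FE Ju1 Jv1 Ju2 Jv2 !bracketE !FE !XJu !XJv; split; ring.
Qed.
End Nijenhuis.

(** * Lie derivatives of one-forms *)

Section LieDerivative.
Context {R : realType} {n : nat} {M : manifold R n}.
Local Notation F := 'C^oo(M).
Local Notation V := (vector_field M).
Implicit Types (X Y Z : V) (a : one_form M).

(** Cartan's formula: the Lie derivative of [a] along [Z] is the contraction of
[d a] with [Z] plus the differential of [a Z], up to the factor in [ext_d]. *)
Lemma lie_one_form a Z Y :
  ext_d a Z Y = 0 -> Y (a Z) = 0 -> Z (a Y) = a (bracket Z Y).
Proof.
move=> dZ aZ; apply: smooth_fun_ext => x.
have := congr1 (fun h : F => h x) dZ.
rewrite /ext_d aZ !FE => /eqP; rewrite mulf_eq0 invr_eq0 pnatr_eq0 /=.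
by rewrite subr0 subr_eq0 => /eqP.
Qed.

(** The exterior derivative commutes with the Lie derivative, by the Jacobi
identity; an invariant form has an invariant differential. *)
Lemma lie_ext_d a Z X Y : (forall W, Z (a W) = a (bracket Z W)) ->
  Z (ext_d a X Y) = ext_d a (bracket Z X) Y + ext_d a X (bracket Z Y).
Proof.
move=> inv.
have jacobi : bracket (bracket Z X) Y + bracket X (bracket Z Y) =
    bracket Z (bracket X Y).
  apply: vector_field_ext => f; rewrite !VE !vfD !vfN.
  by apply: smooth_fun_ext => x; rewrite !FE; ring.
have := congr1 a jacobi; rewrite linearD -inv /= => jac.
rewrite /ext_d vfZ -scalerDr; apply: congr1.
rewrite !vfD !vfN -{}jac !bracketE -!inv.
by apply: smooth_fun_ext => x; rewrite !FE; ring.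
Qed.

End LieDerivative.

(** * Riemannian metrics and Killing fields *)

Section Metric.
Context {R : realType} {n : nat} {M : manifold R n}.
Local Notation F := 'C^oo(M).
Local Notation V := (vector_field M).
Implicit Types (X Y Z : V) (g : V -> V -> F).

Section Bilinear.
Context (g : V -> V -> F) (gP : riemannian_metric g).

Lemma metricC X Y : g X Y = g Y X. Proof. by case: gP. Qed.

Lemma metricDl X Y Z : g (X + Y) Z = g X Z + g Y Z.
Proof. by case: gP => _ /(_ 1 X Y Z); rewrite scale1r mul1r. Qed.

Lemma metric0l Z : g 0 Z = 0.
Proof. by apply: (addrI (g 0 Z)); rewrite -metricDl !addr0. Qed.

Lemma metricZl f X Z : g (f *: X) Z = f * g X Z.
Proof. by case: gP => _ /(_ f X 0 Z); rewrite addr0 metric0l addr0. Qed.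

Lemma metricNl X Z : g (- X) Z = - g X Z.
Proof. by rewrite -scaleN1r metricZl mulN1r. Qed.

Lemma metricDr X Y Z : g Z (X + Y) = g Z X + g Z Y.
Proof. by rewrite metricC metricDl !(metricC Z). Qed.

Lemma metricZr f X Z : g Z (f *: X) = f * g Z X.
Proof. by rewrite metricC metricZl metricC. Qed.

Lemma metricNr X Z : g Z (- X) = - g Z X.
Proof. by rewrite metricC metricNl metricC. Qed.

Lemma metric_nondegenerate X : g X X = 0 -> X = 0.
Proof.
move=> gXX; apply: vector_field_ext => f; apply: smooth_fun_ext => x.
have [_ _ pos] := gP.
have [X0|/pos] := pselect (vanishes_at X x); first exact: X0.
by rewrite gXX ltxx.
Qed.

End Bilinear.

Definition killing g Z : Prop := forall X Y,
  Z (g X Y) = g (bracket Z X) Y + g X (bracket Z Y).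

(** The derivative of [g X Y] along [Z] is computed by metric compatibility, and
torsion-freeness turns [nabla Z X - bracket Z X] into [nabla X Z]. *)
Lemma killing_nabla g nabla Z X Y :
  riemannian_metric g -> levi_civita g nabla -> killing g Z ->
  g (nabla X Z) Y + g X (nabla Y Z) = 0.
Proof.
move=> gP [_ _ _ tor met] /(_ X Y).
rewrite met -!tor metricDl // metricNl // metricDr // metricNr // => eq.
apply: smooth_fun_ext => x; have := congr1 (fun h : F => h x) eq.
by rewrite !FE; lra.
Qed.

End Metric.

(** * Metric contact pairs *)

Section ContactPair.
Context {R : realType} {n : nat} {M : manifold R n}.
Local Notation F := 'C^oo(M).
Local Notation V := (vector_field M).
Implicit Types (a : one_form M) (X Y Z : V) (phi : {linear V -> V})
  (g : V -> V -> F).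

(** These conditions are stable under exchange of the two members of the pair;
integrability of [J] and of [T], which get exchanged, is assumed separately. *)
Definition metric_pair a1 a2 Z1 Z2 phi g : Prop :=
  [/\ reeb_fields a1 a2 Z1 Z2, almost_contact_pair a1 a2 Z1 Z2 phi,
      riemannian_metric g & associated_metric a1 a2 Z1 Z2 phi g].

Lemma metric_pair_swap a1 a2 Z1 Z2 phi g :
  metric_pair a1 a2 Z1 Z2 phi g -> metric_pair a2 a1 Z2 Z1 phi g.
Proof.
move=> [[[a11 a12 a21 a22] d1 d2] [phi2 pZ1 pZ2] gP [gphi gZ1 gZ2]]; split=> //.
- by split=> // Y; [have [] := d2 Y|have [] := d1 Y].
- by split=> // X; rewrite phi2 addrAC.
- by split=> // X Y; rewrite gphi addrC.
Qed.

Definition lie_phi phi Z Y : V := bracket Z (phi Y) - phi (bracket Z Y).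

Lemma reeb_invariant a1 a2 Z1 Z2 : reeb_fields a1 a2 Z1 Z2 ->
  (forall Y, Z1 (a1 Y) = a1 (bracket Z1 Y)) /\
  (forall Y, Z1 (a2 Y) = a2 (bracket Z1 Y)).
Proof.
move=> [[a11 a12 a21 a22] d1 d2]; split=> Y; have [d11 d21] := d1 Y;
  by apply: lie_one_form => //; rewrite ?a11 ?a21 ?vf1 ?vf0.
Qed.

Section Pair.
Context (a1 a2 : one_form M) (Z1 Z2 : V) (phi : {linear V -> V})
  (g : V -> V -> F) (mP : metric_pair a1 a2 Z1 Z2 phi g).

(** [a1 (phi Y)] is [g Z1 (phi Y)], hence the contraction of
[d a1 + d a2] with a Reeb field. *)
Lemma form_phi Y : a1 (phi Y) = 0.
Proof.
have [[_ d1 _] [_ pZ1 _] gP [gphi gZ1 gZ2]] := mP.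
have [d11 d21] := d1 Y.
by rewrite -gZ1 metricC // gphi d11 d21 addr0.
Qed.

(** The image of [phi] and the Reeb fields span, so a tensorial identity need
only be tested on them. *)
Lemma phi_decomposition Y :
  Y = phi (- phi Y) + (a1 Y : F) *: Z1 + (a2 Y : F) *: Z2.
Proof.
have [_ [phi2 _ _] _ _] := mP.
rewrite linearN /= phi2; apply: vector_field_ext => f; rewrite !VE.
by apply: smooth_fun_ext => x; rewrite !FE; ring.
Qed.

Lemma eq0_of_pairings X :
  a1 X = 0 -> a2 X = 0 -> (forall Y, g X (phi Y) = 0) -> X = 0.
Proof.
have [_ _ gP _] := mP.
move=> aX bX gX; apply: (metric_nondegenerate gP).
by rewrite [X in g _ X]phi_decomposition aX bX !scale0r !addr0 gX.
Qed.

(** The forms [a_j] vanish on the bracket because [a_j Z2] is constant, and so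
do the contractions of [d a_j] with it, because [d a_j] is invariant under
[Z1] and its contraction with [Z2] is zero. *)
Lemma bracket_reeb : bracket Z1 Z2 = 0.
Proof.
have [rP _ gP [gphi _ _]] := mP.
have [inv1 inv2] := reeb_invariant rP.
have [[a11 a12 a21 a22] d1 d2] := rP.
apply: eq0_of_pairings => [||Y].
- by rewrite -inv1 a12 vf0.
- by rewrite -inv2 a22 vf1.
have [dZ1 dZ2] := d2 Y; have [dB1 dB2] := d2 (bracket Z1 Y).
have := lie_ext_d Z2 Y inv1; have := lie_ext_d Z2 Y inv2.
by rewrite gphi dZ1 dZ2 dB1 dB2 !vf0 !addr0 => <- <-; rewrite addr0.
Qed.

End Pair.

Lemma form_phi2 a1 a2 Z1 Z2 phi g Y :
  metric_pair a1 a2 Z1 Z2 phi g -> a2 (phi Y) = 0.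
Proof. by move=> /metric_pair_swap mP; exact: form_phi mP Y. Qed.

(** Both [a_j] and the relation [a_j (phi Y) = 0] are invariant under [Z1].  On
the common kernel of the [a_j], the endomorphisms [phi], [J] and [T] agree. *)
Lemma lie_phi_form a1 a2 Z1 Z2 phi g Y : metric_pair a1 a2 Z1 Z2 phi g ->
  a1 (lie_phi phi Z1 Y) = 0 /\ a2 (lie_phi phi Z1 Y) = 0.
Proof.
move=> mP; have [rP _ _ _] := mP.
have [inv1 inv2] := reeb_invariant rP.
rewrite /lie_phi !linearB /= -inv1 -inv2.
by rewrite !(form_phi mP) !(form_phi2 _ mP) vf0 subrr.
Qed.

Section ComplexStructure.
Context (a1 a2 : one_form M) (Z1 Z2 : V) (phi : {linear V -> V})
  (g : V -> V -> F) (mP : metric_pair a1 a2 Z1 Z2 phi g).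
Local Notation J := (contact_pair_J a1 a2 Z1 Z2 phi).

Lemma contact_pair_JD X Y : J (X + Y) = J X + J Y.
Proof.
rewrite /contact_pair_J !linearD; apply: vector_field_ext => f; rewrite !VE.
by apply: smooth_fun_ext => x; rewrite !FE; ring.
Qed.

Lemma contact_pair_JJ X : J (J X) = - X.
Proof.
have [[[a11 a12 a21 a22] _ _] [phi2 pZ1 pZ2] _ _] := mP.
have a1J : a1 (J X) = - a2 X.
  rewrite /contact_pair_J linearD linearB /= !one_formZ (form_phi mP) a11 a12.
  by apply: smooth_fun_ext => x; rewrite !FE; ring.
have a2J : a2 (J X) = a1 X.
  rewrite /contact_pair_J linearD linearB /= !one_formZ (form_phi2 _ mP) a21 a22.
  by apply: smooth_fun_ext => x; rewrite !FE; ring.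
rewrite {1}/contact_pair_J a1J a2J.
rewrite /contact_pair_J linearD linearB !linearZ /= pZ1 pZ2 phi2.
apply: vector_field_ext => f; rewrite !VE.
by apply: smooth_fun_ext => x; rewrite !FE; ring.
Qed.

(** [J] differs from [phi] by terms built from the invariant [a_j] and [Z_j], so
both have the same Lie derivative. *)
Lemma lie_contact_pair_J Z Y :
  bracket Z Z1 = 0 -> bracket Z Z2 = 0 ->
  Z (a1 Y) = a1 (bracket Z Y) -> Z (a2 Y) = a2 (bracket Z Y) ->
  bracket Z (J Y) = lie_phi phi Z Y + J (bracket Z Y).
Proof.
move=> ZZ1 ZZ2 inv1 inv2.
rewrite /contact_pair_J !bracketDr bracketNr !bracketZr ZZ1 ZZ2 inv1 inv2.
rewrite !scaler0 !addr0 /lie_phi.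
by rewrite !addrA subrK.
Qed.

(** Since [J Z1 = Z2] and [J (J X) = - X], the Nijenhuis tensor at [Z1] and [Y]
is [(L_Z2 J) Y - J ((L_Z1 J) Y)]. *)
Lemma lie_phi_exchange Y : Defs.integrable J ->
  lie_phi phi Z2 Y = phi (lie_phi phi Z1 Y).
Proof.
move=> /integrable_nijenhuis => /(_ Z1 Y).
have [rP [phi2 pZ1 pZ2] _ _] := mP.
have [inv11 inv12] := reeb_invariant rP.
have [rP' _ _ _] := metric_pair_swap mP.
have [inv22 inv21] := reeb_invariant rP'.
have [[a11 a12 a21 a22] _ _] := rP.
have b12 := bracket_reeb mP.
have JZ1 : J Z1 = Z2.
  by rewrite /contact_pair_J pZ1 a11 a21 scale0r scale1r subr0 add0r.
have [l1 l2] := lie_phi_form Y mP.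
have Jlie : J (lie_phi phi Z1 Y) = phi (lie_phi phi Z1 Y).
  by rewrite /contact_pair_J l1 l2 !scale0r subr0 addr0.
rewrite /nijenhuis JZ1.
rewrite (lie_contact_pair_J (Z := Z1)) ?bracketxx //.
rewrite (lie_contact_pair_J (Z := Z2)) ?bracketxx //; last first.
  by rewrite bracketC b12 oppr0.
rewrite contact_pair_JD contact_pair_JJ Jlie => N0.
by apply/eqP; rewrite -subr_eq0 -{}N0; apply/eqP;
  apply: vector_field_ext => f; rewrite !VE;
  apply: smooth_fun_ext => x; rewrite !FE; ring.
Qed.

End ComplexStructure.

(** * The Reeb fields are Killing *)

Section Killing.
Context (a1 a2 : one_form M) (Z1 Z2 : V) (phi : {linear V -> V})
  (g : V -> V -> F) (mP : metric_pair a1 a2 Z1 Z2 phi g)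
  (Jint : Defs.integrable (contact_pair_J a1 a2 Z1 Z2 phi))
  (Tint : Defs.integrable (contact_pair_T a1 a2 Z1 Z2 phi)).

Lemma contact_pair_T_swap :
  contact_pair_T a1 a2 Z1 Z2 phi = contact_pair_J a2 a1 Z2 Z1 phi.
Proof. by apply/funext => X; rewrite /contact_pair_T /contact_pair_J addrAC. Qed.

(** Integrability of [J] and of [T] gives [L_Z1 phi = phi (phi (L_Z1 phi))], and
[phi (phi W) = - W] on the kernel of both [a_j]. *)
Lemma lie_phi0 Y : lie_phi phi Z1 Y = 0.
Proof.
have [_ [phi2 _ _] _ _] := mP.
have L2 := lie_phi_exchange mP Y Jint.
have L1 : lie_phi phi Z1 Y = phi (lie_phi phi Z2 Y).
  apply: (lie_phi_exchange (metric_pair_swap mP)).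
  by rewrite -contact_pair_T_swap.
have [l1 l2] := lie_phi_form Y mP.
move: L1; rewrite L2 phi2 l1 l2 !scale0r !addr0 => L1.
apply: vector_field_ext => f; apply: smooth_fun_ext => x.
have := congr1 (fun X : V => X f x) L1.
by rewrite VE !FE; lra.
Qed.

Lemma reeb_killing : killing g Z1.
Proof.
have [rP _ gP [gphi gZ1 gZ2]] := mP.
have [inv1 inv2] := reeb_invariant rP.
(* The defect of invariance is tensorial in the second argument, so it suffices
   that it vanishes on the image of [phi] and on the Reeb fields. *)
move=> X Y; pose inv W := Z1 (g X W) = g (bracket Z1 X) W + g X (bracket Z1 W).
have invD W W' : inv W -> inv W' -> inv (W + W').
  rewrite /inv bracketDr !metricDr // vfD => -> ->.
  by apply: smooth_fun_ext => x; rewrite !FE; ring.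
have invZ f W : inv W -> inv (f *: W).
  rewrite /inv bracketZr metricDr // !metricZr // vfM => ->.
  by apply: smooth_fun_ext => x; rewrite !FE; ring.
have inv_phi W : inv (phi W).
  have /eqP := lie_phi0 W; rewrite subr_eq0 => /eqP lie0.
  rewrite /inv lie0 !gphi vfD !lie_ext_d //.
  by apply: smooth_fun_ext => x; rewrite !FE; ring.
have invZ1 : inv Z1 by rewrite /inv !gZ1 bracketxx metricC // metric0l // addr0.
have invZ2 : inv Z2.
  by rewrite /inv !gZ2 (bracket_reeb mP) [g X 0]metricC // metric0l // addr0.
change (inv Y); rewrite (phi_decomposition mP Y).
by apply: (invD _ _ (invD _ _ (inv_phi _) (invZ _ _ _)) (invZ _ _ _)).
Qed.

End Killing.

(** The covariant derivative of the metric dual of [Z]. *)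
Lemma form_derivative g nabla a Z X Y : levi_civita g nabla ->
  (forall W, g W Z = a W) -> X (a Y) = a (nabla X Y) + g Y (nabla X Z).
Proof. by move=> [_ _ _ _ met] ga; rewrite -!ga met. Qed.

End ContactPair.

(** * The cyclic Ricci condition *)

Theorem theorem5p1 (R : realType) (p q : nat) (hp : (0 < p)%N) (hq : (0 < q)%N)
    (M : manifold R (2 * p + 2 * q + 2))
    (a1 a2 : one_form M) (Z1 Z2 : vector_field M)
    (phi : {linear vector_field M -> vector_field M})
    (g : vector_field M -> vector_field M -> 'C^oo(M))
    (nabla : vector_field M -> vector_field M -> vector_field M)
    (Ric : vector_field M -> vector_field M -> 'C^oo(M))
    (lambda : M -> R) :
  normal_metric_contact_pair p q a1 a2 Z1 Z2 phi g ->
  levi_civita g nabla ->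
  is_ricci nabla Ric ->
  generalized_quasi_einstein Ric g a1 a2
    lambda (fun x => (2 * p)%:R - lambda x) (fun x => (2 * q)%:R - lambda x) ->
  (forall x y, lambda x = lambda y) ->
  cyclic_ricci nabla Ric.
Proof.
move=> [[_ reeb] [acp _] [gP assoc] Jint Tint] lc _ qe lambda_cst X1 X2 X3.
have mP : metric_pair a1 a2 Z1 Z2 phi g by [].
have [_ gZ1 gZ2] := assoc.
have kil1 := reeb_killing mP Jint Tint.
have kil2 : killing g Z2.
  apply: (reeb_killing (metric_pair_swap mP)).
  - by rewrite -contact_pair_T_swap.
  - by rewrite contact_pair_T_swap.
have [_ _ _ _ met] := lc.
(* The constant value of [lambda] is read off at [x], since [M] has no
   distinguished point. *)
apply: smooth_fun_ext => x.
have RicE X Y : Ric X Y = lambda x *: g X Y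
    + ((2 * p)%:R - lambda x) *: ((a1 X : 'C^oo(M)) * a1 Y)
    + ((2 * q)%:R - lambda x) *: ((a2 X : 'C^oo(M)) * a2 Y).
  by apply: smooth_fun_ext => y; rewrite qe (lambda_cst y x) !FE !mulrA.
rewrite /covariant_derivative !RicE !vfD !vfZ !vfM !met.
rewrite !(form_derivative _ _ lc gZ1) !(form_derivative _ _ lc gZ2).
have anti Z : killing g Z -> forall X Y,
    g X (nabla Y Z) x = - g Y (nabla X Z) x.
  move=> kil X Y; have := killing_nabla X Y gP lc kil.
  move=> /(congr1 (fun h : 'C^oo(M) => h x)); rewrite metricC // !FE; lra.
rewrite !FE (anti Z1 kil1 X2 X1) (anti Z1 kil1 X3 X2) (anti Z1 kil1 X1 X3).
rewrite (anti Z2 kil2 X2 X1) (anti Z2 kil2 X3 X2) (anti Z2 kil2 X1 X3).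
ring.
Qed.
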